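(* Let $V$ and $W$ be finite-dimensional real inner product spaces, let $A\colon V\to V$ be a symmetric positive semidefinite linear operator, and let $B\colon V\to W$ be a surjective linear operator with $\mathcal{N}(A)\cap\mathcal{N}(B)=\{0\}$. Let $W_0=\{Bv : v\in\mathcal{N}(A)\}^{\perp}\subset W$, let $P\colon W\to W_0$ be the orthogonal projection onto $W_0$, and let $S_0=P\,B\,A^{+}B^t\,P^t\colon W_0\to W_0$, where $A^+$ is a pseudoinverse of $A$. Let $L\colon W_0\to W_0$ be a symmetric positive definite linear operator. Then $$\lambda_{\min}(LS_0)=\inf_{0\neq q\in W_0}\ \sup_{v\in\mathcal{R}(A),\ PBv=q}\frac{(Lq,q)}{(Av,v)},\qquad \lambda_{\max}(LS_0)=\sup_{0\neq v\in\mathcal{R}(A)}\frac{(LPBv,PBv)}{(Av,v)}.$$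
   Context: All inner products are denoted $(\cdot,\cdot)$; $W_0$ carries the inner product of $W$. $\mathcal{N}(\cdot)$ and $\mathcal{R}(\cdot)$ denote null space and range; a superscript $t$ denotes the adjoint of a linear operator; in particular $P^t\colon W_0\to W$ is the adjoint of $P\colon W\to W_0$ (the inclusion of $W_0$ in $W$). $X^\perp$ is the orthogonal complement of $X$. A pseudoinverse of $A$ is a linear operator $A^+\colon V\to V$ such that $AA^+$ acts as the identity on $\mathcal{R}(A)$; $S_0$ does not depend on the choice of $A^+$ and is symmetric positive definite. ''Symmetric positive (semi)definite'' means self-adjoint with $(Av,v)>0$ for all $v\neq 0$ (respectively $(Av,v)\ge 0$ for all $v$). $S_0$ is the projected Schur complement of the saddle point system $Au+B^tp=f$, $Bu=g$ (with $f\in V$, $g\in W$). $\lambda_{\min}$ and $\lambda_{\max}$ denote the minimum and maximum eigenvalues of an operator (so $W_0$ is understood to be nonzero). *)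

(* Defs.v *)
From HB Require Import structures.
From mathcomp Require Import all_boot all_order all_algebra.
From mathcomp Require Import sesquilinear.
From mathcomp Require Import all_classical all_reals ereal.

Set Implicit Arguments.
Unset Strict Implicit.
Unset Printing Implicit Defensive.

Import Order.TTheory GRing.Theory Num.Theory.
Local Open Scope ring_scope.

(* A finite-dimensional real inner product space is a [vectType R], with
   [R : realType], together with a form [ip : {dot V for @idfun R}], i.e. a
   symmetric positive definite bilinear form. *)

Section RestrictedInnerProduct.
Variables (R : realType) (V : vectType R) (ip : {dot V for @idfun R}).
Variable U : {vspace V}.

Definition sub_ip (u v : subvs_of U) : R := ip (vsval u) (vsval v).

Let sub_ip_bilinear : bilinear_for *%R (@idfun R \; *%R) sub_ip.
Proof. by split=> w a u v; rewrite /sub_ip /= ?linearPl ?linearPr. Qed.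
HB.instance Definition _ :=
  bilinear_isBilinear.Build R _ _ _ _ _ sub_ip sub_ip_bilinear.

Let sub_ip_herm u v : sub_ip u v = (-1) ^+ false * @idfun R (sub_ip v u).
Proof. exact: hermitian_subproof. Qed.
HB.instance Definition _ :=
  isHermitianSesquilinear.Build R _ _ _ sub_ip sub_ip_herm.

Let sub_ip_gt0 u : u != 0 -> 0 < sub_ip u u.
Proof. by move=> u0; apply: neq0_dnorm_gt0; rewrite -(inj_eq val_inj) in u0. Qed.
HB.instance Definition _ := isDotProduct.Build R _ sub_ip sub_ip_gt0.
End RestrictedInnerProduct.

Section Coordinates.
Variables (R : realType) (V : vectType R) (ip : {dot V for @idfun R}).
Variables (n : nat) (h : 'I_n -> V).

Definition ip_row (v : V) : 'rV[R]_n := \row_i ip (h i) v.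

Let ip_row_linear : linear ip_row.
Proof. by move=> a u v; apply/rowP => i; rewrite !mxE linearPr. Qed.
HB.instance Definition _ :=
  GRing.isLinear.Build R V 'rV[R]_n _ ip_row ip_row_linear.
End Coordinates.

Section Adjoint.
Variables (R : realType) (V W : vectType R).
Variables (ipV : {dot V for @idfun R}) (ipW : {dot W for @idfun R}).
Variable f : 'Hom(V, W).

Definition is_adjoint (g : 'Hom(W, V)) : Prop :=
  forall v w, ipW (f v) w = ipV v (g w).

Definition adjoint : 'Hom(W, V) := xget 0 (is_adjoint : set 'Hom(W, V)).

Lemma ip_ext (x y : V) : (forall v, ipV v x = ipV v y) -> x = y.
Proof.
move=> xy; apply/eqP; rewrite -subr_eq0; apply/negPn/negP.
move=> /(@neq0_dnorm_gt0 _ _ _ ipV).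
suff -> : ipV (x - y) (x - y) = 0 by rewrite ltxx.
by rewrite linearBr; apply/eqP; rewrite subr_eq0; apply/eqP/xy.
Qed.

Lemma adjointP : is_adjoint adjoint.
Proof.
pose b := vbasis {:V}; pose n := \dim {:V}.
pose c : 'Hom(V, 'rV[R]_n) := linfun (ip_row ipV (fun i : 'I_n => b`_i)).
pose F : 'Hom(W, 'rV[R]_n) :=
  linfun (ip_row ipW (fun i : 'I_n => f b`_i)).
have cE v i : c v 0 i = ipV b`_i v by rewrite /c lfunE /= mxE.
have FE w i : F w 0 i = ipW (f b`_i) w by rewrite /F lfunE /= mxE.
have kc : lker c == 0%VS.
  apply/lker0P => x y /rowP exy; apply: ip_ext => v.
  rewrite (coord_vbasis (memvf v)) !linear_sumlz; apply: eq_bigr => i _.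
  by rewrite !linearZl_LR /= -!cE exy.
have imc : limg c = fullv.
  apply/eqP; rewrite eqEdim subvf /= limg_dim_eq ?(eqP kc) ?capv0 //.
  by rewrite dimvf /dim /= mul1n.
pose g := (c^-1 \o F)%VF.
have gE w : c (g w) = F w.
  by rewrite comp_lfunE; apply: limg_lfunVK; rewrite imc memvf.
suff : is_adjoint g by move=> /(xgetI 0).
move=> v w; rewrite (coord_vbasis (memvf v)) linear_sum !linear_sumlz.
apply: eq_bigr => i _.
by rewrite linearZ !linearZl_LR /= -FE -gE cE.
Qed.

Lemma is_adjoint_uniq g : is_adjoint g -> g = adjoint.
Proof.
move=> gP; apply/lfunP => w; apply: ip_ext => v.
by rewrite -gP -adjointP.
Qed.
End Adjoint.

Section OrthogonalProjection.
Variables (R : realType) (W : vectType R) (ip : {dot W for @idfun R}).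
Variable U : {vspace W}.

(* [daddv_pi U U'] projects onto [U] along [U'].  By itself [vsproj U] projects
   along an arbitrary complement of [U]; here it is applied to elements of [U],
   so it only changes the codomain from [W] to [subvs_of U]. *)
Definition orth_proj : 'Hom(W, subvs_of U) :=
  (linfun (vsproj U) \o daddv_pi U (orthov ip U))%VF.

Lemma capv_orthov : (U :&: orthov ip U = 0)%VS.
Proof.
apply/eqP; rewrite -subv0; apply/subvP => u.
rewrite memv_cap => /andP[uU /mem_orthovP/(_ u uU) uu].
by rewrite memv0; apply/negPn/negP => /(@neq0_dnorm_gt0 _ _ _ ip); rewrite uu ltxx.
Qed.

Lemma addv_orthov : (U + orthov ip U = fullv)%VS.
Proof.
apply/eqP; rewrite eqEsubv subvf /=; apply/subvP => w _.
pose inc : 'Hom(subvs_of U, W) := linfun vsval.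
pose p := adjoint (sub_ip ip (U := U)) ip inc w.
rewrite -(subrKC (vsval p) w); apply: memv_add; first exact: subvsP.
apply/mem_orthovP => u uU.
have := adjointP (sub_ip ip (U := U)) ip inc (Subvs uU) w.
rewrite /inc lfunE /= -/inc -/p /sub_ip /= => e.
rewrite hermC /= expr0 mul1r linearBr; apply/eqP.
by rewrite subr_eq0; apply/eqP/e.
Qed.

Lemma orth_projP w u : u \in U -> ip (w - vsval (orth_proj w)) u = 0.
Proof.
move=> uU; have := daddv_pi_add capv_orthov (w := w).
rewrite addv_orthov memvf => /(_ isT) e.
rewrite /orth_proj lfunE /= lfunE /= vsprojK ?memv_pi //.
rewrite -{1}e [X in X - _]addrC addrK.
by have /mem_orthovP -> := memv_pi (orthov ip U) U w.
Qed.
End OrthogonalProjection.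

Section Operators.
Variables (R : realType) (V : vectType R) (ip : {dot V for @idfun R}).
Implicit Types f g : 'End(V).

Definition self_adjoint f : Prop := adjoint ip ip f = f.

Definition sym_posdef f : Prop :=
  self_adjoint f /\ (forall v, v != 0 -> 0 < ip (f v) v).

Definition sym_possemidef f : Prop :=
  self_adjoint f /\ (forall v, 0 <= ip (f v) v).

Definition is_pseudoinverse f g : Prop := {in limg f, forall y, f (g y) = y}.
End Operators.

Section ExtremeEigenvalues.
Variables (R : realType) (V : vectType R).

(* [passmx.leigenvalue f a] says that [ker (f - a id)] is nontrivial. *)
Definition is_lambda_min (f : 'End(V)) (a : R) : Prop :=
  passmx.leigenvalue f a /\ (forall b, passmx.leigenvalue f b -> a <= b).

Definition is_lambda_max (f : 'End(V)) (a : R) : Prop :=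
  passmx.leigenvalue f a /\ (forall b, passmx.leigenvalue f b -> b <= a).
End ExtremeEigenvalues.

Section ProjectedSchurComplement.
Variables (R : realType) (V W : vectType R).
Variables (ipV : {dot V for @idfun R}) (ipW : {dot W for @idfun R}).
Variables (A : 'End(V)) (B : 'Hom(V, W)).

Definition W0 : {vspace W} := orthov ipW (B @: lker A).

Definition ipW0 : {dot (subvs_of W0) for @idfun R} := sub_ip ipW (U := W0).

Definition projW0 : 'Hom(W, subvs_of W0) := orth_proj ipW W0.

(* [Ap] is meant to be a pseudoinverse of [A], see [is_pseudoinverse]. *)
Definition S0 (Ap : 'End(V)) : 'End(subvs_of W0) :=
  (projW0 \o B \o Ap \o adjoint ipV ipW B \o adjoint ipW ipW0 projW0)%VF.
End ProjectedSchurComplement.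

(* Main.v *)
Require Import Defs.
From mathcomp Require Import all_boot all_order all_algebra.
From mathcomp Require Import sesquilinear.
From mathcomp Require Import all_classical all_reals ereal.
From mathcomp Require Import ring lra.

(** Put [C = P B : V -> W0].  It vanishes on [ker A] and is onto, its adjoint is
    [B^t P^t], and [S_0 = C A^+ C^t].

    Every [q] in [W0] has a lift [w] in the range of [A] with [A w = C^t q] and
    [C w = S_0 q] ([schur_lift]), and then [(A w, v) = (q, C v)] for all [v].  In
    words, [w] represents the functional [v |-> (q, C v)] in the energy
    form of [A], and its energy is [(S_0 q, q)].  So [S_0] is symmetric positive
    definite, and the Cauchy-Schwarz inequality for the energy form reads
    [(q, C v)^2 <= (S_0 q, q) (A v, v)] ([schur_CauchySchwarz]), with equality
    when [v] is a multiple of [w].  The suprema and the infimum of the theorem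
    are thereby exchanged for Rayleigh quotients of [S_0].

    The operator [L S_0] need not be self-adjoint, but [L S_0 (L r) = l L r]
    is the eigenvalue problem of the self-adjoint operator [L S_0 L] relative to
    the positive definite [L].  Its extreme eigenvalues exist and are the extreme
    values of [(S_0 L r, L r) / (L r, r)] ([pencil_max], [pencil_min]).  That is
    shown by completeness of the reals rather than by compactness: if [l] is the
    supremum of the quotient [(S v, v) / (M v, v)], then [l M - S] is
    semidefinite, and if it had no kernel, it would be definite and hence dominate
    a multiple of [M] ([posdef_dominates]), so that [l] could be lowered.

    For the maximum, Cauchy-Schwarz with [q = L C v] gives
    [(L C v, C v) <= l_max (A v, v)] ([rayleigh_le_energy]), and the lift of an
    eigenvector attains equality ([energy_attained]).  For the minimum, the lift
    in the fibre [C v = q] of least energy shows that the inner supremum is at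
    least [l_min] for each [q] ([energy_le_rayleigh]), while on an eigenvector [q]
    it is at most [l_min] by [rayleigh_le_energy] again. *)

Set Implicit Arguments.
Unset Strict Implicit.
Unset Printing Implicit Defensive.

Import Order.TTheory GRing.Theory Num.Theory.
Local Open Scope classical_set_scope.
Local Open Scope ring_scope.

(** * Semidefinite and definite operators *)

Section DefiniteOperators.
Variables (R : realType) (V : vectType R) (ip : {dot V for @idfun R}).
Implicit Types (f g : 'End(V)) (u v : V).

(* Once the bundled rules such as [linearDl] have been rewritten with, a goal
   carries the form through another inheritance path, and later rewrites fail to
   match it; the copies below fix one path. *)
Lemma ipC u v : ip u v = ip v u.
Proof. by rewrite hermC /= expr0 mul1r. Qed.

Lemma ipZl a u v : ip (a *: u) v = a * ip u v.
Proof. by rewrite linearZl_LR. Qed.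

Lemma ipZr a u v : ip u (a *: v) = a * ip u v.
Proof. by rewrite linearZr_LR. Qed.

Lemma ipDl u v w : ip (u + v) w = ip u w + ip v w.
Proof. exact: linearDl. Qed.

Lemma ipDr u v w : ip u (v + w) = ip u v + ip u w.
Proof. exact: linearDr. Qed.

Lemma ipNl u v : ip (- u) v = - ip u v.
Proof. exact: linearNl. Qed.

Lemma ipNr u v : ip u (- v) = - ip u v.
Proof. exact: linearNr. Qed.

Lemma ipBl u v w : ip (u - v) w = ip u w - ip v w.
Proof. exact: linearBl. Qed.

Lemma ip_suml n (F : 'I_n -> V) v : ip (\sum_i F i) v = \sum_i ip (F i) v.
Proof. exact: linear_sumlz. Qed.

Lemma ip_eq0 u : ip u u = 0 -> u = 0.
Proof.
move=> uu0; apply/eqP/negPn/negP => /(@neq0_dnorm_gt0 _ _ _ ip).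
by rewrite uu0 ltxx.
Qed.

Lemma self_adjointP f :
  self_adjoint ip f <-> forall u v, ip (f u) v = ip u (f v).
Proof.
split=> [fS u v|fS]; first by rewrite (adjointP ip ip) fS.
by rewrite /self_adjoint -(@is_adjoint_uniq _ _ _ ip ip f f).
Qed.

Lemma posdef_semidef f : sym_posdef ip f -> sym_possemidef ip f.
Proof.
case=> fS f0; split=> // v; have [->|/f0/ltW//] := eqVneq v 0.
by rewrite linear0r.
Qed.

Lemma possemidef_CauchySchwarz f u v : sym_possemidef ip f ->
  ip (f u) v ^+ 2 <= ip (f u) u * ip (f v) v.
Proof.
case=> /self_adjointP fS f0.
have quad s t : 0 <= s ^+ 2 * ip (f u) u + 2 * s * t * ip (f u) v
                     + t ^+ 2 * ip (f v) v.
  have := f0 (s *: u + t *: v).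
  have -> : f (s *: u + t *: v) = s *: f u + t *: f v by rewrite linearD !linearZ.
  rewrite ipDl !ipDr !ipZl !ipZr.
  rewrite (fS v u) (ipC v (f u)).
  by move=> h; apply: le_trans h _; rewrite le_eqVlt; apply/orP; left; apply/eqP; ring.
have [v0|v0] := eqVneq (ip (f v) v) 0.
  (* The inequality [quad] is then affine in [t], and forces
     [ip (f u) v ^+ 2 * (a + 2) <= 0] for [a = ip (f u) u]. *)
  have := quad (ip (f u) v) (- (ip (f u) u + 1)).
  have := f0 u; rewrite v0.
  move: (ip (f u) u) (ip (f u) v) => a b a0 h.
  have : 0 <= b ^+ 2 by exact: sqr_ge0.
  move: h; nra.
have v1 : 0 < ip (f v) v by rewrite lt_def v0 f0.
(* Up to the factor [ip (f v) v], this is [s = 1] and the [t] that minimises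
   the quadratic polynomial [quad]. *)
have := quad (ip (f v) v) (- ip (f u) v).
rewrite -(ler_pM2l v1).
move: (ip (f u) u) (ip (f u) v) (ip (f v) v) => a b c h.
rewrite -subr_ge0; apply: le_trans h _; rewrite le_eqVlt; apply/orP; left; apply/eqP; ring.
Qed.

Lemma possemidef_eq0 f v : sym_possemidef ip f -> ip (f v) v = 0 -> f v = 0.
Proof.
move=> fP v0; apply: ip_eq0; apply/eqP; rewrite -sqrf_eq0 eq_le sqr_ge0 andbT.
by have := possemidef_CauchySchwarz v (f v) fP; rewrite v0 mul0r.
Qed.

Lemma posdef_ker0 f : sym_posdef ip f -> lker f == 0%VS.
Proof.
case=> fS f0; rewrite -subv0; apply/subvP => v; rewrite memv_ker memv0 => /eqP v0.
by apply/negPn/negP => /f0; rewrite v0 linear0l ltxx.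
Qed.

Lemma possemidef_ker0 f :
  sym_possemidef ip f -> lker f == 0%VS -> sym_posdef ip f.
Proof.
move=> fP /lker0P finj; case: (fP) => fS f0; split=> // v vn0.
rewrite lt_def f0 andbT; apply: contraNneq vn0 => /(possemidef_eq0 fP) v0.
by apply/eqP/finj; rewrite v0 linear0.
Qed.

(** The coordinates of a vector in some basis are written as inner products, so
    that they can be estimated by the Cauchy-Schwarz inequality. *)
Lemma dual_basis : exists n (b c : 'I_n -> V),
  forall v, v = \sum_i ip (b i) v *: c i.
Proof.
pose n := \dim {:V}; pose b (i : 'I_n) := (vbasis {:V})`_i.
pose F : 'Hom(V, 'rV[R]_n) := linfun (ip_row ip b).
have FE v i : F v 0 i = ip (b i) v by rewrite /F lfunE /= mxE.
have kF : lker F == 0%VS.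
  apply/lker0P => x y /rowP exy; apply: (@ip_ext _ _ ip) => v.
  rewrite (coord_vbasis (memvf v)) !linear_sumlz; apply: eq_bigr => i _.
  by rewrite !linearZl_LR /= -!FE exy.
exists n, b, (fun i => (F^-1)%VF (delta_mx 0 i)) => v.
rewrite -{1}[v](lker0_lfunK kF) (row_sum_delta (F v)) linear_sum.
by apply: eq_bigr => i _; rewrite linearZ /= FE.
Qed.

(** Replaces the compactness of the unit sphere.  Expanded in a dual basis,
    [ip (T v) v] is a sum of terms [ip (b i) v * ip (T (c i)) v]; since [G] is
    onto, both factors are of the form [ip (G x) v], and the Cauchy-Schwarz
    inequality for [G] bounds them by multiples of the square root of
    [ip (G v) v]. *)
Lemma posdef_dominates (G T : 'End(V)) : sym_posdef ip G ->
  exists K, 0 < K /\ forall v, ip (T v) v <= K * ip (G v) v.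
Proof.
move=> GP; have [n [b [c bcE]]] := dual_basis.
have G0 := (posdef_semidef GP).2; have GK := lker0_lfunVK (posdef_ker0 GP).
have /self_adjointP GS := GP.1.
pose x i := (G^-1)%VF (b i); pose y i := (G^-1)%VF (T (c i)).
(* From [p ^+ 2 <= r * t] and [q ^+ 2 <= s * t] one gets [p * q <= (r + s) * t];
   the summand [1] only makes the constant positive. *)
exists (1 + \sum_i (ip (G (x i)) (x i) + ip (G (y i)) (y i))); split.
  by rewrite ltr_pwDl // sumr_ge0 // => i _; rewrite addr_ge0.
move=> v; rewrite {1}(bcE v) linear_sum ip_suml mulrDl mul1r mulr_suml.
rewrite -[leLHS]add0r lerD //; apply: ler_sum => i _.
rewrite linearZ ipZl /= -(GK (b i)) -(GK (T (c i))) -/(x i) -/(y i).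
have := possemidef_CauchySchwarz (x i) v (posdef_semidef GP).
have := possemidef_CauchySchwarz (y i) v (posdef_semidef GP).
have := G0 v; have := G0 (x i); have := G0 (y i).
move: (ip (G (x i)) v) (ip (G (y i)) v) (ip (G (x i)) _) (ip (G (y i)) _) => p q r s.
move: (ip _ _) => t *; nra.
Qed.

(** The largest eigenvalue of the pencil [S - l M] is the supremum [l] of the
    quotient [ip (S v) v / ip (M v) v].  If [l M - S] had no kernel, it would be
    positive definite, so [M <= C (l M - S)] for some [C > 0] by
    [posdef_dominates], and [l - C^-1] would still bound the quotient. *)
Lemma pencil_max (M S : 'End(V)) :
  (exists v : V, v != 0) -> sym_posdef ip M -> self_adjoint ip S ->
  exists l p, [/\ p != 0, S p = l *: M p &
    forall v, ip (S v) v <= l * ip (M v) v].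
Proof.
move=> [v0 v0n0] MP /self_adjointP SS; have /self_adjointP MS := MP.1.
pose E := [set ip (S v) v / ip (M v) v | v in [set v : V | v != 0]].
have E0 : E !=set0 by exists (ip (S v0) v0 / ip (M v0) v0); exists v0.
have [K [K0 KP]] := posdef_dominates S MP.
have Eub : has_ubound E.
  by exists K => _ [v /= vn0 <-]; rewrite ler_pdivrMr ?KP // MP.2.
pose l := sup E.
have lP v : ip (S v) v <= l * ip (M v) v.
  have [->|vn0] := eqVneq v 0; first by rewrite !linear0r mulr0.
  by rewrite -ler_pdivrMr ?MP.2 //; apply: ub_le_sup => //; exists v.
pose G : 'End(V) := l *: M - S.
have GE u v : ip (G u) v = l * ip (M u) v - ip (S u) v.
  by rewrite add_lfunE opp_lfunE scale_lfunE ipBl ipZl.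
have Gsd : sym_possemidef ip G.
  split; last by move=> v; rewrite GE subr_ge0.
  apply/self_adjointP => u v.
  by rewrite [RHS]ipC !GE (MS u v) (SS u v) (ipC (M v)) (ipC (S v)).
have [kG|] := boolP (lker G == 0%VS); last first.
  rewrite -subv0 => /subvPn [p]; rewrite memv_ker memv0 => /eqP Gp p0.
  exists l, p; split=> //; apply/esym/eqP; rewrite -subr_eq0.
  by rewrite -Gp add_lfunE opp_lfunE scale_lfunE.
have [C [C0 CP]] := posdef_dominates M (possemidef_ker0 Gsd kG).
have : l <= l - C^-1.
  apply: ge_sup => // _ [v /= vn0 <-]; rewrite ler_pdivrMr ?MP.2 //.
  have := CP v; rewrite GE -(ler_pM2l (_ : 0 < C^-1)) ?invr_gt0 // mulKf ?gt_eqF // => h.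
  rewrite mulrBl; lra.
have : 0 < C^-1 by rewrite invr_gt0.
lra.
Qed.

Lemma pencil_min (M S : 'End(V)) :
  (exists v : V, v != 0) -> sym_posdef ip M -> self_adjoint ip S ->
  exists l p, [/\ p != 0, S p = l *: M p &
    forall v, l * ip (M v) v <= ip (S v) v].
Proof.
move=> V0 MP /self_adjointP SS.
have NS : self_adjoint ip (- S).
  by apply/self_adjointP => u v; rewrite !opp_lfunE ipNl ipNr SS.
have [l [p [p0 Sp lP]]] := pencil_max V0 MP NS.
exists (- l), p; split=> // [|v].
  by rewrite scaleNr -Sp opp_lfunE opprK.
by rewrite mulNr lerNl; have := lP v; rewrite opp_lfunE ipNl.
Qed.

Lemma limg_self_adjoint f : self_adjoint ip f -> limg f = orthov ip (lker f).
Proof.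
move=> /self_adjointP fS; apply/eqP; rewrite eqEdim; apply/andP; split.
  apply/subvP => _ /memv_imgP [u _ ->]; apply/mem_orthovP => v.
  by rewrite memv_ker => /eqP v0; apply: etrans (fS u v) _; rewrite v0 linear0r.
rewrite -(leq_add2l (\dim (lker f))).
have -> : (\dim (lker f) + \dim (limg f) = \dim {:V})%N.
  by rewrite -(limg_ker_dim f fullv) capfv.
by rewrite -dimv_disjoint_sum ?capv_orthov // addv_orthov.
Qed.

Lemma leigenvalueP f a :
  reflect (exists2 v : V, v != 0 & f v = a *: v) (passmx.leigenvalue f a).
Proof.
have memE v : (v \in passmx.leigenspace f a) = (f v == a *: v).
  rewrite memv_ker add_lfunE opp_lfunE scale_lfunE id_lfunE.
  by rewrite subr_eq0.
rewrite /passmx.leigenvalue -subv0; apply: (iffP (@subvPn _ _ _ _)) => -[v].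
  by rewrite memE memv0 => /eqP; exists v.
by move=> v0 fv; exists v; rewrite ?memE ?fv ?memv0.
Qed.

End DefiniteOperators.

(** * The Schur complement of a constraint that vanishes on the kernel *)

Section SchurComplement.
Variables (R : realType) (V U : vectType R).
Variables (ipV : {dot V for @idfun R}) (ipU : {dot U for @idfun R}).
Variables (A Ap : 'End(V)) (C : 'Hom(V, U)) (L : 'End(U)).
Hypotheses (A_spsd : sym_possemidef ipV A) (Ap_pinv : is_pseudoinverse A Ap).
Hypotheses (C_surj : limg C = fullv) (kerAC : (lker A <= lker C)%VS).
Hypothesis L_spd : sym_posdef ipU L.

Let Ct := adjoint ipV ipU C.
Let S : 'End(U) := (C \o Ap \o Ct)%VF.

(** [w] is the component of [Ap (Ct q)] in the range of [A], along the kernel.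
    Dropping the kernel component changes neither [A w] nor [C w], as [C] vanishes
    on [ker A]; and [A (Ap (Ct q)) = Ct q] because [Ct] maps into the orthogonal
    complement of [ker A], which is the range of [A]. *)
Lemma schur_lift q : exists w, [/\ w \in limg A, A w = Ct q & C w = S q].
Proof.
have Cq : Ct q \in limg A.
  rewrite (limg_self_adjoint A_spsd.1); apply/mem_orthovP => v vA.
  rewrite [LHS](ipC ipV) -(adjointP ipV ipU C).
  by move/subvP: kerAC => /(_ v vA); rewrite memv_ker => /eqP ->; rewrite linear0l.
have : Ap (Ct q) \in (lker A + limg A)%VS.
  by rewrite (limg_self_adjoint A_spsd.1) addv_orthov memvf.
case/memv_addP => k kA [w wA wE]; exists w; split=> //.
  rewrite -[RHS](Ap_pinv Cq) wE linearD /=.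
  by move: kA; rewrite memv_ker => /eqP ->; rewrite add0r.
rewrite /S !comp_lfunE wE linearD /=.
by move/subvP: kerAC => /(_ k kA); rewrite memv_ker => /eqP ->; rewrite add0r.
Qed.

Lemma lift_energy q w v : A w = Ct q -> ipV (A w) v = ipU q (C v).
Proof. by move=> ->; rewrite (ipC ipV) -adjointP (ipC ipU). Qed.

Lemma energy_sym v w : ipV (A v) w = ipV (A w) v.
Proof. by have /self_adjointP -> := A_spsd.1; rewrite (ipC ipV). Qed.

Lemma energy_gt0 v : v \in limg A -> v != 0 -> 0 < ipV (A v) v.
Proof.
rewrite (limg_self_adjoint A_spsd.1) => vA v0; rewrite lt_def A_spsd.2 andbT.
apply: contraNneq v0 => /(possemidef_eq0 A_spsd) Av0.
rewrite -memv0 -(capv_orthov ipV (lker A)) memv_cap vA memv_ker.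
by rewrite Av0 eqxx.
Qed.

(** With lifts [v] of [p] and [w] of [q], [(S p, q)] is the energy product of [v]
    and [w].  Definiteness needs [w != 0] when [q != 0]: otherwise [Ct q = 0],
    and [q] is orthogonal to the range of [C], which is everything. *)
Lemma schur_spd : sym_posdef ipU S.
Proof.
split; first apply/self_adjointP => p q.
  have [v [_ Av Cv]] := schur_lift p; have [w [_ Aw Cw]] := schur_lift q.
  rewrite -Cv -Cw (ipC ipU) -(lift_energy _ Aw) -(lift_energy _ Av).
  exact: energy_sym.
move=> q q0; have [w [wA Aw Cw]] := schur_lift q.
rewrite (ipC ipU) -Cw -(lift_energy _ Aw); apply: energy_gt0 => //.
apply: contraNneq q0 => w0; apply/eqP/(ip_eq0 (ip := ipU)).
have : q \in limg C by rewrite C_surj memvf.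
case/memv_imgP => v _ {2}->.
by rewrite -(lift_energy _ Aw) w0 !linear0 linear0l.
Qed.

(** The lift [w] of [q] turns the energy product [(A w, v)] into [(q, C v)] and
    the energy [(A w, w)] into [(S q, q)]. *)
Lemma schur_CauchySchwarz q v :
  ipU q (C v) ^+ 2 <= ipU (S q) q * ipV (A v) v.
Proof.
have [w [wA Aw Cw]] := schur_lift q.
have := possemidef_CauchySchwarz w v A_spsd.
by rewrite !(lift_energy _ Aw) Cw (ipC ipU _ (S _)).
Qed.

(** [schur_CauchySchwarz] with [q = L (C v)], divided by [(L (C v), C v)]. *)
Lemma rayleigh_le_energy l v : 0 < l ->
  ipU (S (L (C v))) (L (C v)) <= l * ipU (L (C v)) (C v) ->
  ipU (L (C v)) (C v) <= l * ipV (A v) v.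
Proof.
move=> l0 lP; have [Cv0|Cv0] := eqVneq (C v) 0.
  by rewrite Cv0 linear0r; apply: mulr_ge0; [exact: ltW|exact: A_spsd.2].
have := schur_CauchySchwarz (L (C v)) v.
have := lP; have := A_spsd.2 v; have := L_spd.2 _ Cv0.
move: (ipU _ _) (ipU _ _) (ipV _ _) => a b e b0 e0 ab h.
have : b ^+ 2 <= b * (l * e).
  by apply: le_trans h _; rewrite mulrA (mulrC b); apply: ler_wpM2r.
by rewrite expr2 ler_pM2l.
Qed.

(** Equality in [rayleigh_le_energy]: [v] is the lift of [L r], which [C] maps to
    [S (L r) = l *: r], divided by [l]. *)
Lemma energy_attained l r : 0 < l -> S (L r) = l *: r ->
  exists v, [/\ v \in limg A, C v = r & l * ipV (A v) v = ipU (L r) r].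
Proof.
move=> l0 Sr; have [w [wA Aw Cw]] := schur_lift (L r).
exists (l^-1 *: w); split; first exact: memvZ.
  by rewrite linearZ /= Cw Sr scalerA mulVf ?gt_eqF // scale1r.
have -> : A (l^-1 *: w) = l^-1 *: A w by rewrite linearZ.
rewrite (ipZl ipV) (ipZr ipV) (lift_energy _ Aw) Cw Sr (ipZr ipU).
by rewrite !mulrA mulfV ?gt_eqF // mul1r mulVf ?gt_eqF // mul1r.
Qed.

(** The lift [w] of [L r], where [r] solves [S (L r) = q], lies in the fibre
    [C w = q] and has energy [(L r, q)].  As [l (L r, r) <= (L r, q)], the
    Cauchy-Schwarz inequality [(L r, q)^2 <= (L r, r) (L q, q)] for [L] yields
    [l (L r, q) <= (L q, q)]. *)
Lemma energy_le_rayleigh l : 0 < l ->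
  (forall r, l * ipU (L r) r <= ipU (S (L r)) (L r)) ->
  forall q, exists v, [/\ v \in limg A, C v = q & l * ipV (A v) v <= ipU (L q) q].
Proof.
move=> l0 lP q; pose r := (L^-1)%VF ((S^-1)%VF q).
have Sr : S (L r) = q.
  by rewrite /r (lker0_lfunVK (posdef_ker0 L_spd)) (lker0_lfunVK (posdef_ker0 schur_spd)).
have [w [wA Aw Cw]] := schur_lift (L r).
exists w; split=> //; first by rewrite Cw.
rewrite (lift_energy _ Aw) Cw Sr; have := lP r; rewrite Sr (ipC ipU q).
have := possemidef_CauchySchwarz r q (posdef_semidef L_spd).
have := (posdef_semidef L_spd).2 q; have := (posdef_semidef L_spd).2 r.
move: (ipU (L r) q) (ipU (L r) r) (ipU (L q) q) => a b c b0 c0 h lb.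
have a0 : 0 <= a by apply: le_trans lb; rewrite mulr_ge0 // ltW.
move: a0; rewrite le_eqVlt => /orP [/eqP<-|a0]; first by rewrite mulr0.
rewrite -(ler_pM2l a0) mulrCA -expr2; apply: le_trans (_ : l * (b * c) <= _).
  by rewrite ler_pM2l.
by rewrite mulrA ler_wpM2r.
Qed.

Hypothesis U_neq0 : exists q : U, q != 0.

(** [S (L r) = l *: r] is equivalent to [T r = l *: L r], and [T], unlike [L \o S],
    is self-adjoint: this is the pencil to diagonalise. *)
Let T : 'End(U) := (L \o S \o L)%VF.

Let TE r : T r = L (S (L r)).
Proof. by rewrite 2!comp_lfunE. Qed.

Lemma schur_pencilE r : ipU (T r) r = ipU (S (L r)) (L r).
Proof. by rewrite TE; have /self_adjointP -> := L_spd.1. Qed.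

Lemma schur_pencil_self_adjoint : self_adjoint ipU T.
Proof.
apply/self_adjointP => p q; rewrite !TE.
have /self_adjointP LS := L_spd.1; have /self_adjointP SS := schur_spd.1.
by rewrite LS SS LS.
Qed.

(** Eigenvectors of [L S] are the images under the bijection [L] of eigenvectors
    of [S L]. *)
Lemma schur_eigenvalueP b :
  passmx.leigenvalue (L \o S)%VF b <-> exists2 r, r != 0 & S (L r) = b *: r.
Proof.
have LK := lker0_lfunVK (posdef_ker0 L_spd); have /lker0P Linj := posdef_ker0 L_spd.
split=> [/leigenvalueP [p p0]|[r r0 Sr]].
  rewrite comp_lfunE => LSp; exists ((L^-1)%VF p).
    by apply: contraNneq p0 => p0; rewrite -(LK p) p0 linear0.
  by rewrite LK; apply: Linj; rewrite LSp linearZ /= LK.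
apply/leigenvalueP; exists (L r); last by rewrite comp_lfunE Sr linearZ.
by apply: contraNneq r0 => Lr0; apply/eqP/Linj; rewrite Lr0 linear0.
Qed.

Lemma schur_eigenvalue_rayleigh b r : S (L r) = b *: r ->
  ipU (S (L r)) (L r) = b * ipU (L r) r.
Proof. by move=> ->; rewrite (ipZl ipU) (ipC ipU). Qed.

Lemma schur_eigenvalue_gt0 b r : r != 0 -> S (L r) = b *: r -> 0 < b.
Proof.
move=> r0 Sr; rewrite -(pmulr_lgt0 b (L_spd.2 _ r0)).
rewrite -(schur_eigenvalue_rayleigh Sr); apply: schur_spd.2.
apply: contraNneq r0 => Lr0; have /lker0P Linj := posdef_ker0 L_spd.
by apply/eqP/Linj; rewrite Lr0 linear0.
Qed.

Theorem schur_lambda_max : exists l,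
  is_lambda_max (L \o S)%VF l /\
  l%:E = ereal_sup [set (ipU (L (C v)) (C v) / ipV (A v) v)%:E
                   | v in [set v : V | v \in limg A /\ v != 0]].
Proof.
have [l [r [r0 Tr lP]]] := pencil_max U_neq0 L_spd schur_pencil_self_adjoint.
have Sr : S (L r) = l *: r.
  have /lker0P Linj := posdef_ker0 L_spd.
  by apply: Linj; rewrite linearZ /= -Tr TE.
have l0 := schur_eigenvalue_gt0 r0 Sr.
have {}lP q : ipU (S (L q)) (L q) <= l * ipU (L q) q by rewrite -schur_pencilE.
exists l; split; first split; first by apply/schur_eigenvalueP; exists r.
  move=> b /schur_eigenvalueP [q q0 Sq].
  by rewrite -(ler_pM2r (L_spd.2 _ q0)) -(schur_eigenvalue_rayleigh Sq).
apply/eqP; rewrite eq_le; apply/andP; split.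
  have [v [vA Cv vE]] := energy_attained l0 Sr.
  have v0 : v != 0 by apply: contraNneq r0 => v0; rewrite -Cv v0 linear0.
  apply: ereal_sup_ubound; exists v => //=.
  by rewrite Cv -vE mulfK // gt_eqF // energy_gt0.
apply: ge_ereal_sup => _ [v [/= vA v0] <-].
by rewrite lee_fin ler_pdivrMr ?energy_gt0 // rayleigh_le_energy // lP.
Qed.

(** The same pencil argument at the other end.  In the fibre over [q != 0] all
    energies are positive, since [v = 0] would give [q = C v = 0]. *)
Theorem schur_lambda_min : exists l,
  is_lambda_min (L \o S)%VF l /\
  l%:E = ereal_inf [set ereal_sup [set (ipU (L q) q / ipV (A v) v)%:E
                                  | v in [set v : V | v \in limg A /\ C v = q]]
                   | q in [set q : U | q != 0]].
Proof.
have [l [r [r0 Tr lP]]] := pencil_min U_neq0 L_spd schur_pencil_self_adjoint.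
have Sr : S (L r) = l *: r.
  have /lker0P Linj := posdef_ker0 L_spd.
  by apply: Linj; rewrite linearZ /= -Tr TE.
have l0 := schur_eigenvalue_gt0 r0 Sr.
have {}lP q : l * ipU (L q) q <= ipU (S (L q)) (L q) by rewrite -schur_pencilE.
have energy_fibre_gt0 v q : v \in limg A -> C v = q -> q != 0 -> 0 < ipV (A v) v.
  move=> vA <- q0; apply: energy_gt0 => //.
  by apply: contraNneq q0 => ->; rewrite linear0.
exists l; split; first split; first by apply/schur_eigenvalueP; exists r.
  move=> b /schur_eigenvalueP [q q0 Sq].
  by rewrite -(ler_pM2r (L_spd.2 _ q0)) -(schur_eigenvalue_rayleigh Sq).
apply/eqP; rewrite eq_le; apply/andP; split.
  apply: le_ereal_inf_tmp => _ [q /= q0 <-].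
  have [v [vA Cv vP]] := energy_le_rayleigh l0 lP q.
  apply: le_trans (ereal_sup_ubound _); last by exists v.
  by rewrite lee_fin ler_pdivlMr // (energy_fibre_gt0 _ q).
apply: le_trans (ereal_inf_lbound _) _; first by exists r.
apply: ge_ereal_sup => _ [v [/= vA Cv] <-].
rewrite lee_fin ler_pdivrMr ?(energy_fibre_gt0 _ r) // -Cv.
by apply: rayleigh_le_energy; rewrite // Cv (schur_eigenvalue_rayleigh Sr).
Qed.

End SchurComplement.

(** * The constraint projected onto the complement of the image of the kernel *)

Section ProjectedConstraint.
Variables (R : realType) (V W : vectType R) (ipW : {dot W for @idfun R}).
Variables (A : 'End(V)) (B : 'Hom(V, W)).

Lemma orth_proj_id (Z : {vspace W}) w : w \in Z -> vsval (orth_proj ipW Z w) = w.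
Proof.
move=> wZ; apply/esym/eqP; rewrite -subr_eq0 -memv0 -(capv_orthov ipW Z) memv_cap.
rewrite memvB ?subvsP //=; apply/mem_orthovP => u uZ; exact: orth_projP.
Qed.

Lemma orth_proj_eq0 (Z : {vspace W}) w : w \in orthov ipW Z -> orth_proj ipW Z w = 0.
Proof.
move=> /mem_orthovP wZ; apply/val_inj/(ip_eq0 (ip := ipW)) => /=.
set p := vsval _; have pZ : p \in Z by apply: subvsP.
have := orth_projP ipW w pZ; rewrite -/p (ipBl ipW) (wZ _ pZ) sub0r.
by move/eqP; rewrite oppr_eq0 => /eqP.
Qed.

Lemma limg_projW0 : limg B = fullv -> limg (projW0 ipW A B \o B)%VF = fullv.
Proof.
move=> Bs; apply/eqP; rewrite eqEsubv subvf; apply/subvP => q _.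
have : vsval q \in limg B by rewrite Bs memvf.
case/memv_imgP => v _ qv; apply/memv_imgP; exists v; rewrite ?memvf //.
by apply: val_inj; rewrite comp_lfunE -qv /= orth_proj_id ?subvsP.
Qed.

(** [B] maps [ker A] into [B (ker A)], hence into the orthogonal complement of
    [W0 = (B (ker A))^perp], which the projection kills. *)
Lemma lker_projW0 : (lker A <= lker (projW0 ipW A B \o B))%VS.
Proof.
apply/subvP => v vA; rewrite memv_ker comp_lfunE; apply/eqP/orth_proj_eq0.
apply/mem_orthovP => w /mem_orthovP wW0; rewrite [LHS](ipC ipW).
exact/wW0/memv_img.
Qed.

End ProjectedConstraint.

Lemma adjoint_comp (R : realType) (V W Z : vectType R)
    (ipV : {dot V for @idfun R}) (ipW : {dot W for @idfun R})
    (ipZ : {dot Z for @idfun R}) (f : 'Hom(V, W)) (g : 'Hom(W, Z)) :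
  adjoint ipV ipZ (g \o f)%VF = (adjoint ipV ipW f \o adjoint ipW ipZ g)%VF.
Proof.
apply/esym/is_adjoint_uniq => v z.
by rewrite !comp_lfunE /= (adjointP ipW ipZ) (adjointP ipV ipW).
Qed.

Theorem theorem4p6 (R : realType) (V W : vectType R)
    (ipV : {dot V for @idfun R}) (ipW : {dot W for @idfun R})
    (A : 'End(V)) (B : 'Hom(V, W))
    (A_spsd : sym_possemidef ipV A)
    (B_surj : limg B = fullv)
    (capAB : (lker A :&: lker B = 0)%VS)
    (W0_neq0 : W0 ipW A B != 0%VS)
    (Ap : 'End(V)) (Ap_pinv : is_pseudoinverse A Ap)
    (L : 'End(subvs_of (W0 ipW A B)))
    (L_spd : sym_posdef (ipW0 ipW A B) L) :
  exists lmin lmax : R,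
    [/\ is_lambda_min (L \o S0 ipV ipW A B Ap)%VF lmin,
        lmin%:E =
          ereal_inf [set
            ereal_sup [set (ipW0 ipW A B (L q) q / ipV (A v) v)%:E
                      | v in [set v : V | v \in limg A /\
                                          projW0 ipW A B (B v) = q]]
                    | q in [set q : subvs_of (W0 ipW A B) | q != 0]],
        is_lambda_max (L \o S0 ipV ipW A B Ap)%VF lmax
      & lmax%:E =
          ereal_sup [set (ipW0 ipW A B (L (projW0 ipW A B (B v))) (projW0 ipW A B (B v))
                            / ipV (A v) v)%:E
                    | v in [set v : V | v \in limg A /\ v != 0]]].
Proof.
have U0 : exists q : subvs_of (W0 ipW A B), q != 0.
  move: W0_neq0; rewrite -vpick0 => w0; exists (Subvs (memv_pick (W0 ipW A B))).
  by rewrite -(inj_eq val_inj).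
have Cs := limg_projW0 ipW A B_surj; have kC := lker_projW0 ipW A B.
have SE : S0 ipV ipW A B Ap = (projW0 ipW A B \o B \o Ap
    \o adjoint ipV (ipW0 ipW A B) (projW0 ipW A B \o B))%VF.
  by rewrite (adjoint_comp ipV ipW) comp_lfunA.
have [lmin [minP minE]] := schur_lambda_min A_spsd Ap_pinv Cs kC L_spd U0.
have [lmax [maxP maxE]] := schur_lambda_max A_spsd Ap_pinv Cs kC L_spd U0.
exists lmin, lmax; rewrite SE; split=> //.
  rewrite minE; congr ereal_inf; apply: eq_imagel => q _; congr ereal_sup.
  apply/seteqP; split=> _ [v [/= vA Cv] <-]; exists v => //; split=> //.
    by rewrite comp_lfunE in Cv; exact: Cv.
  by rewrite comp_lfunE.
rewrite maxE; congr ereal_sup; apply: eq_imagel => v _.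
by rewrite comp_lfunE.
Qed.
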